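(* For every prime $p$, with $C_p^n=C_p\times\cdots\times C_p$ ($n$ factors), $$\lim_{n\to\infty}\mathcal{V}(C_p^n)=0.$$
   Context: For a finite group $G$, $L(G)$ denotes the set of all subgroups of $G$ (including the trivial subgroup and $G$ itself), $s(G)$ denotes the number of subgroups of $G$ that are simple groups (the trivial group is not simple; cyclic groups of prime order are simple), and $\mathcal{V}(G)=s(G)/|L(G)|$. Subgroups are counted as subsets of $G$. $C_p$ is the cyclic group of order $p$. *)

(* Defs.v *)
From HB Require Import structures.
From mathcomp Require Import all_boot all_order all_algebra all_fingroup all_solvable.
From mathcomp Require Import all_classical all_reals all_analysis.

Set Implicit Arguments.
Unset Strict Implicit.
Unset Printing Implicit Defensive.

Import Order.TTheory GRing.Theory Num.Theory.
Import numFieldNormedType.Exports.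

Local Open Scope ring_scope.

Definition simple_subgroups (gT : finGroupType) (G : {group gT}) :
    {set {group gT}} :=
  [set H in subgroups G | simple H].

Definition simple_ratio (R : realType) (gT : finGroupType) (G : {group gT}) : R :=
  #|simple_subgroups G|%:R / #|subgroups G|%:R.

(* The external direct product of n copies of C_p.  As a [finGroupType], ['Z_p]
   carries its additive group law, which is cyclic of order p when 1 < p. *)
Definition Cpow (p n : nat) : finGroupType := {dffun forall i : 'I_n, 'Z_p}.

(* Main.v *)
(* In an abelian group of exponent dividing e, the map (x, y) |-> <x, y> has
   fibres of size at most e^4, so there are at least #|G|^2 / e^4 subgroups, while
   the simple subgroups are cyclic and so number at most #|G|.  For C_p^n the
   ratio is thus at most p^4 / p^n. *)
Require Import Defs.
From HB Require Import structures.
From mathcomp Require Import all_boot all_order all_algebra all_fingroup all_solvable.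
From mathcomp Require Import all_classical all_reals all_analysis.
Import Order.TTheory GRing.Theory Num.Theory.
Import numFieldNormedType.Exports.
Local Open Scope classical_set_scope.
Local Open Scope ring_scope.

(** Every subgroup of an abelian group is normal, so simplicity forces the cycle of any nontrivial
    element to be all of [H]. *)
Lemma simple_abelian_cycle (gT : finGroupType) (H : {group gT}) :
  abelian H -> simple H -> exists2 x, x \in H & H = <[x]>%G.
Proof.
move=> abH /simpleP[/trivgPn[x xH ntx] simH]; exists x => //.
apply/val_inj; case: (simH <[x]>%G) => [|/eqP|//].
  by rewrite -sub_abelian_normal ?cycle_subG.
by rewrite cycle_eq1 (negPf ntx).
Qed.

Lemma card_simple_subgroups_abelian (gT : finGroupType) (G : {group gT}) :
  abelian G -> (#|simple_subgroups G| <= #|G|)%N.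
Proof.
move=> abG; apply: leq_trans (leq_imset_card (fun x => <[x]>%G) G).
apply/subset_leq_card/fintype.subsetP => H; rewrite !inE => /andP[sHG simH].
have [x xH ->] := simple_abelian_cycle _ _ (abelianS sHG abG) simH.
by apply: imset_f; apply: (fintype.subsetP sHG).
Qed.

Lemma card_pair_gen_abelian (gT : finGroupType) (G : {group gT}) (e : nat) x y :
    abelian G -> (0 < e)%N -> (exponent G %| e)%N -> x \in G -> y \in G ->
  (#|(<[x]> <*> <[y]>)%g| <= e ^ 2)%N.
Proof.
move=> abG e0 expG xG yG.
have order_le z : z \in G -> (#[z]%g <= e)%N.
  by move=> zG; apply: dvdn_leq => //; apply: dvdn_trans (dvdn_exponent zG) expG.
rewrite cent_joinEr; last first.
  by apply: (fintype.subset_trans _ (fintype.subset_trans abG (centS _))); rewrite cycle_subG.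
(* Since the cycles commute, their join is their product set; its order times that of the
   intersection is [#[x] * #[y]]. *)
apply: leq_trans (leq_pmulr _ (cardG_gt0 (<[x]> :&: <[y]>)%G)) _.
by rewrite -mul_cardG; apply: leq_mul; apply: order_le.
Qed.

Lemma card_subgroups_abelian (gT : finGroupType) (G : {group gT}) (e : nat) :
    abelian G -> (0 < e)%N -> (exponent G %| e)%N ->
  (#|G| ^ 2 <= #|subgroups G| * e ^ 4)%N.
Proof.
move=> abG e0 expG.
pose gen2 (u : gT * gT) := (<[u.1]> <*> <[u.2]>)%G.
have -> : (#|G| ^ 2)%N = #|finset.setX G G| by rewrite cardsX.
rewrite -sum1_card (partition_big gen2 (mem (subgroups G))) /=; last first.
  by case=> x y /setXP[xG yG]; rewrite inE join_subG !cycle_subG xG yG.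
rewrite -sum_nat_const; apply: leq_sum => H _.
rewrite sum1_card.
(* A subgroup needing more than two generators may exceed [e ^ 2] elements, but its fibre is empty.
   Otherwise a pair in the fibre bounds [#|H|]. *)
case: (set_0Vmem [set u in finset.setX G G | gen2 u == H]) => [fib0 | [[x y]]].
  rewrite (eq_card0 (A := [pred u | _])) // => u.
  by have /finset.setP/(_ u) := fib0; rewrite !inE.
rewrite !inE /= => /andP[/andP[xG yG] /eqP defH].
have cardH : (#|H| <= e ^ 2)%N.
  by rewrite -defH; apply: card_pair_gen_abelian abG e0 expG xG yG.
(* Both members of a pair lie in the subgroup they generate, so the fibre over [H] sits inside
   [H * H]. *)
apply: (@leq_trans #|finset.setX H H|).
  apply/subset_leq_card/fintype.subsetP => -[a b] /andP[_ /eqP <-].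
  by rewrite inE /= -!cycle_subG joing_subl joing_subr.
by rewrite cardsX (_ : e ^ 4 = e ^ 2 * e ^ 2)%N ?leq_mul // -expnD.
Qed.

(** Both sides are compared with [#|G| ^ 2]; the cross-multiplied form keeps the estimate in
    [nat]. *)
Lemma simple_subgroups_le (gT : finGroupType) (G : {group gT}) (e : nat) :
    abelian G -> (0 < e)%N -> (exponent G %| e)%N ->
  (#|simple_subgroups G| * #|G| <= #|subgroups G| * e ^ 4)%N.
Proof.
move=> abG e0 expG; apply: leq_trans (card_subgroups_abelian _ _ _ abG e0 expG).
by rewrite leq_mul2r card_simple_subgroups_abelian ?orbT.
Qed.

Lemma abelian_Cpow p n : abelian [set: Cpow p n]%G.
Proof.
apply/centsP => f _ g _; apply/ffunP => i.
by rewrite !ffunE; exact: Zp_mulgC.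
Qed.

Lemma expg_Cpow p n (f : Cpow p n) k i : (f ^+ k)%g i = (f i ^+ k)%g.
Proof. by elim: k => [|k IH]; rewrite ?ffunE // !expgS ffunE IH. Qed.

Lemma exponent_Cpow p n : (1 < p)%N -> (exponent [set: Cpow p n]%G %| p)%N.
Proof.
move=> p1; apply/exponentP => f _; apply/ffunP => i.
rewrite expg_Cpow ffunE FinRing.zmodXgE.
by rewrite -mulr_natr pchar_Zp // mulr0.
Qed.

Lemma card_Cpow p n : (1 < p)%N -> #|[set: Cpow p n]%G| = (p ^ n)%N.
Proof.
move=> p1; rewrite cardsT card_dep_ffun foldrE big_map big_enum /=.
(* [Zp_cast] needs [1 < p]: by convention ['Z_0] and ['Z_1] have two elements. *)
by rewrite prod_nat_const card_ord card_ord Zp_cast.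
Qed.

Lemma simple_ratio_Cpow_le (R : realType) p n : (1 < p)%N ->
  simple_ratio R [set: Cpow p n]%G <= p%:R ^+ 4 * p%:R^-1 ^+ n.
Proof.
move=> p1; have p0 : (0 < p)%N := ltnW p1.
have := simple_subgroups_le _ _ _ (abelian_Cpow p n) p0 (exponent_Cpow p n p1).
rewrite card_Cpow // => le_nat.
have L0 : (0 < #|subgroups [set: Cpow p n]%G|)%N.
  by apply/card_gt0P; exists 1%G; rewrite inE sub1G.
rewrite /simple_ratio exprVn ler_pdivrMr ?ltr0n // mulrAC ler_pdivlMr.
  by rewrite mulrC -!natrX -!natrM ler_nat mulnC [leqRHS]mulnC.
by rewrite exprn_gt0 ?ltr0n.
Qed.

Theorem corollary2p8 (R : realType) (p : nat) (hp : prime p) :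
  simple_ratio R [set: Cpow p n]%G @[n --> \oo] --> (0 : R).
Proof.
have p1 := prime_gt1 hp.
apply: (@squeeze_cvgr _ _ _ _ (cst 0) (fun n => p%:R ^+ 4 * p%:R^-1 ^+ n)).
- apply: nearW => n; rewrite simple_ratio_Cpow_le // andbT.
  by rewrite divr_ge0 ?ler0n.
- exact: cvg_cst.
(* For fixed [p] the upper bound is geometric in [n], with ratio [p^-1 < 1]. *)
- apply: cvg_geometric.
  by rewrite ger0_norm ?invr_ge0 ?ler0n // invf_lt1 ?ltr1n // ltr0n ltnW.
Qed.
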